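(* Let $\gamma,\delta\in(0,1)$, let $\delta^{(i)}=\delta/n_P$ for $i\in[n_P]$, let the sample size $D$ satisfy $$D>\max_{i\in[n_P]}\frac{\log(\gamma/n_{\mathrm{tot}})}{\log(1-\delta^{(i)})},$$ and let $\tau_i=F_{\mathrm b}^{-1}\big(\tfrac{\gamma}{n_{\mathrm{tot}}};D,\delta^{(i)}\big)$ for $i\in[n_P]$. Let $\kappa_{\mathcal D}:\mathbb{R}^n\to U$ be a data-dependent control law. If for all $\mathcal D\in\operatorname{supp}(\mathcal D)$ and all $x\in S$ there exist indices $j_i\in[m_i]$, $i\in[n_P]$, with $$c_{ij_i}^\top f(x,\kappa_{\mathcal D}(x))-\tilde b_{ij_i}(x)\ \ge\ -Z^{ij_i}_{(\tau_i)}(x)\qquad\text{for all } i\in[n_P],$$ then $h$ is a $(\delta,\gamma)$-PCBF (probabilistic control barrier function with high confidence).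
   Context: For $k\in\mathbb{N}$, $[k]=\{1,\dots,k\}$. The dynamics are $F(x,u,\xi)=f(x,u)+g(x,\xi)$ with values in $\mathbb{R}^n$, $x\in\mathbb{R}^n$, $u\in U\subseteq\mathbb{R}^m$ ($U$ nonempty, closed, convex), and $\xi$ an $\mathbb{R}^{n_\xi}$-valued random variable with law $\mathbb{P}_\xi$. All maps are measurable. The constant $\alpha\in[0,1]$ is fixed. The function $h:\mathbb{R}^n\to\mathbb{R}$ is $$h(x)=\min_{i\in[n_P]}h_i(x),\qquad h_i(x)=\max_{j\in[m_i]}\big(c_{ij}^\top x-b_{ij}\big),$$ with $n_P,m_i\ge1$ integers, $c_{ij}\in\mathbb{R}^n$, $b_{ij}\in\mathbb{R}$; $n_{\mathrm{tot}}=\sum_{i\in[n_P]}m_i$; the safe set is $S=\{x:h(x)\ge0\}$; and $\tilde b_{ij}(x)=b_{ij}+\alpha h(x)$. Data: $\mathcal D=(\xi_t)_{t\in[D]}$ consists of $D$ samples drawn independently from $\mathbb{P}_\xi$; its law is the product measure $\mathbb{P}_\xi^{D}$, and $\operatorname{supp}(\mathcal D)$ is its support, i.e. the intersection of the closures of all sets of probability one. A data-dependent control law $\kappa_{\mathcal D}$ is a feedback law that depends (measurably) on $\mathcal D$. Set $Z^{ij}_t(x)=c_{ij}^\top g(x,\xi_t)$, $t\in[D]$, with order statistics $Z^{ij}_{(1)}(x)\le\dots\le Z^{ij}_{(D)}(x)$. $F_{\mathrm b}^{-1}(\gamma;D,\delta)$ denotes the $\gamma$-quantile of the binomial distribution with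 $D$ trials and success probability $\delta$, i.e. the smallest integer $t$ with $\mathbb{P}\{\mathrm{Bin}(D,\delta)\le t\}\ge\gamma$; under the stated bound on $D$, $\tau_i\in[D]$. $h$ is a $(\delta,\gamma)$-PCBF if for all $x\in S$ there exists a $\mathcal D$-measurable $u\in U$ such that $$\mathbb{P}_\xi^{D}\Big\{\mathbb{P}_\xi\big\{h(F(x,u,\xi))\ge\alpha h(x)\big\}\ge1-\delta\Big\}\ge1-\gamma,$$ where the outer probability is over $\mathcal D$ and the inner one over a fresh $\xi\sim\mathbb{P}_\xi$ with $\mathcal D$ (hence $u$) held fixed. *)

(* Defs.v *)
From HB Require Import structures.
From mathcomp Require Import all_boot all_order all_algebra.
From mathcomp Require Import all_classical all_reals all_analysis.

Set Implicit Arguments.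
Unset Strict Implicit.
Unset Printing Implicit Defensive.

Import Order.TTheory GRing.Theory Num.Theory.
Import numFieldNormedType.Exports.

Local Open Scope classical_set_scope.
Local Open Scope ring_scope.

(* Borel sigma-algebra; 'cV[R]_n plays the role of R^n. *)
HB.instance Definition _ (R : realType) (m n : nat) :=
  Measurable.copy 'M[R]_(m, n) (g_sigma_algebraType (@open 'M[R]_(m, n))).

(* Product topology; the library only equips tuples with the product
   sigma-algebra. *)
HB.instance Definition _ (n : nat) (T : ptopologicalType) :=
  Topological.copy (n.-tuple T)
    (initial_topology ((fun v i => tnth v i) : n.-tuple T -> {ptws 'I_n -> T})).

Section product_law.
Context d (T : measurableType d) (R : realType).

Definition cons_pair (n : nat) (w : T * n.-tuple T) : n.+1.-tuple T :=
  [the n.+1.-tuple T of w.1 :: w.2].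

Lemma measurable_cons_pair n : measurable_fun setT (@cons_pair n).
Proof. exact: measurable_cons. Qed.

HB.instance Definition _ n :=
  isMeasurableFun.Build _ _ _ _ (@cons_pair n) (@measurable_cons_pair n).

(* The n-fold product measure P^n, that is, the law of n independent draws
   from P; it is characterized by product_lawE below. *)
Fixpoint product_law (P : probability T R) (n : nat) :
    probability (n.-tuple T) R :=
  match n with
  | 0 => dirac [tuple] : probability _ _
  | n'.+1 => distribution (P \x product_law P n')%E (@cons_pair n')
  end.

Lemma product_lawE (P : probability T R) n (A : 'I_n -> set T) :
  (forall i, measurable (A i)) ->
  product_law P n [set v | forall i, A i (tnth v i)] = (\prod_(i < n) P (A i))%E.
Proof.
elim: n A => [|n IHn] A mA.
  rewrite big_ord0 /= diracE mem_set//= => -[].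
  by [].
rewrite big_ord_recl -IHn//= /distribution /pushforward /=.
have -> : cons_pair (n:=n) @^-1` [set v | forall i, A i (tnth v i)] =
    A ord0 `*` [set v | forall i, A (lift ord0 i) (tnth v i)].
  apply/seteqP; split => [[x v]/= Av|[x v]/= [Ax Av] i].
    by split => [|i]; [exact: (Av ord0)|have := Av (lift ord0 i); rewrite tnthS].
  by case: (unliftP ord0 i) => [j|] -> //; rewrite tnthS.
rewrite product_measure1E//.
rewrite (_ : [set v | _] =
    \bigcap_(i in [set: 'I_n]) ((@tnth n T)^~ i @^-1` A (lift ord0 i))); last first.
  by apply/seteqP; split => v /= Av i => [_|]; exact: Av.
apply: fin_bigcap_measurable => // i _.
by rewrite -[X in measurable X]setTI; exact: measurable_tnth.
Qed.

End product_law.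

(* Intersection of the closures of all sets of probability one. *)
Definition prob_support (R : realType) (k D : nat)
    (Q : probability (D.-tuple 'cV[R]_k) R) : set (D.-tuple 'cV[R]_k) :=
  \bigcap_(A in [set A | measurable A /\ Q A = 1%E]) closure A.

Definition dot (R : realType) (n : nat) (c x : 'cV[R]_n) : R :=
  (c^T *m x) 0 0.

(* Minimum and maximum of a nonempty finite family. *)
Definition fmin (R : realType) (p : nat) (F : 'I_p.+1 -> R) : R :=
  \big[Num.min/F ord0]_(i < p.+1) F i.

Definition fmax (R : realType) (p : nat) (F : 'I_p.+1 -> R) : R :=
  \big[Num.max/F ord0]_(i < p.+1) F i.

(* h(x) = min_i max_j (c_ij^T x - b_ij), where n_P = p.+1 and m_i = (q i).+1,
   so that both are at least 1. *)
Definition hfun (R : realType) (n p : nat) (q : 'I_p.+1 -> nat)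
    (c : forall i, 'I_(q i).+1 -> 'cV[R]_n) (b : forall i, 'I_(q i).+1 -> R)
    (x : 'cV[R]_n) : R :=
  fmin (fun i => fmax (fun j : 'I_(q i).+1 => dot (c i j) x - b i j)).

Definition safe_set (R : realType) (n : nat) (h : 'cV[R]_n -> R) :
    set 'cV[R]_n :=
  [set x | 0 <= h x].

(* Z_(k), with k counted from 1. *)
Definition order_stat (R : realType) (D : nat) (Z : 'I_D -> R) (k : nat) : R :=
  nth 0 (sort <=%R (codom Z)) k.-1.

(* Smallest t with P(Bin(D, delta) <= t) >= gamma; t = D qualifies as soon as
   gamma <= 1. *)
Definition binom_quantile (R : realType) (gamma : R) (D : nat) (delta : R) :
    nat :=
  [arg min_(t < ord_max :> 'I_D.+1
    | (gamma%:E <= binomial_prob D delta [set k | (k <= t)%N])%E) t].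

(* h is a (delta, gamma)-PCBF for the dynamics F with inputs in U, noise law P
   and D samples. *)
Definition is_PCBF (R : realType) (n m nxi : nat)
    (F : 'cV[R]_n -> 'cV[R]_m -> 'cV[R]_nxi -> 'cV[R]_n) (U : set 'cV[R]_m)
    (P : probability 'cV[R]_nxi R) (D : nat) (alpha : R) (h : 'cV[R]_n -> R)
    (delta gamma : R) : Prop :=
  forall x, safe_set h x ->
  exists u : D.-tuple 'cV[R]_nxi -> 'cV[R]_m,
    [/\ measurable_fun setT u,
        forall data, U (u data) &
        ((1 - gamma)%:E <= product_law P D [set data |
          (1 - delta)%:E <= P [set xi | (alpha * h x <= h (F x (u data) xi))%R]]
        )%E].

(* Main.v *)
(* For fixed i, j the scores Z_t = c_ij^T g(x, xi_t) are i.i.d.  Let z be a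
   delta_i-quantile of their law: P(Z <= z) >= delta_i, and P(Z < y) > delta_i
   forces y > z.  If P(Z < Z_(tau_i)) > delta_i, then fewer than tau_i samples
   lie in {Z <= z}, whose number is Bin(D, P(Z <= z)); binomial lower tails
   decrease in the success probability, so by minimality of tau_i this has
   probability less than gamma / n_tot.  A union bound over all pairs (i, j)
   costs gamma, and, off these events, a union bound over i for the fresh sample
   costs delta.  The hypothesis is only used on the support of the data, which
   has full measure because R^k has a countable base. *)

Require Import Defs.
From mathcomp Require Import all_boot all_order all_algebra.
From mathcomp Require Import all_classical all_reals all_analysis.
From mathcomp Require Import lra measurable_realfun.

Set Implicit Arguments.
Unset Strict Implicit.
Unset Printing Implicit Defensive.

Import Order.TTheory GRing.Theory Num.Theory.
Import numFieldNormedType.Exports.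

Local Open Scope classical_set_scope.
Local Open Scope ring_scope.

(** * Lower tails of the binomial distribution *)

(* P(Bin(n, p) < k), by conditioning on the first trial, which is how
   product_law peels off the first draw. *)
Fixpoint binom_lt (R : realType) (n k : nat) (p : R) : R :=
  match k, n with
  | 0%N, _ => 0
  | _.+1, 0%N => 1
  | k'.+1, n'.+1 => p * binom_lt n' k' p + (1 - p) * binom_lt n' k'.+1 p
  end.

Lemma binom_lt0 (R : realType) n (p : R) : binom_lt n 0 p = 0.
Proof. by case: n. Qed.

Lemma binom_lt_nondecreasing (R : realType) n k (p : R) : 0 <= p <= 1 ->
  binom_lt n k p <= binom_lt n k.+1 p.
Proof.
move=> /andP[p0 p1]; elim: n k => [|n IHn] [|k] //=.
  rewrite binom_lt0 mulr0 add0r mulr_ge0 ?subr_ge0// -[leLHS](binom_lt0 n p).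
  exact: IHn.
by rewrite lerD// ler_wpM2l// subr_ge0.
Qed.

(** The recursion averages [binom_lt n k] and [binom_lt n k.+1] with weights [p] and [1 - p]; the
    former is the smaller, so a larger [p] moves weight onto it. *)
Lemma binom_lt_antimono (R : realType) n k (p p' : R) :
  0 <= p -> p <= p' -> p' <= 1 -> binom_lt n k p' <= binom_lt n k p.
Proof.
move=> p0 pp' p'1; elim: n k => [|n IHn] [|k] //=.
have Lkp' : binom_lt n k p' <= binom_lt n k.+1 p'.
  by rewrite binom_lt_nondecreasing// (le_trans p0 pp').
have := IHn k; have := IHn k.+1; nra.
Qed.

(** The recursion of [binom_lt] is Pascal's rule for the binomial weights. *)
Lemma binom_ltE (R : realType) n k (p : R) :
  binom_lt n k p = \sum_(j < k) binomial_pmf n p j.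
Proof.
elim: n k => [|n IHn] [|k]; rewrite ?big_ord0//=.
  rewrite big_ord_recl /= big1 => [|i _]; last by rewrite /binomial_pmf.
  by rewrite /binomial_pmf bin0 !expr0 mulr1 mulr1n addr0.
rewrite !IHn big_ord_recl mulrDr addrCA [RHS]big_ord_recl; congr (_ + _).
  by rewrite /binomial_pmf !bin0 !expr0 !mul1r !subn0 exprS.
rewrite !mulr_sumr -big_split /=; apply: eq_bigr => i _.
rewrite /binomial_pmf /bump /= add1n binS mulrnDr subSS addrC; congr (_ + _).
  (* For [n < i.+1] the exponent [n - i.+1] is truncated, but the binomial coefficient vanishes. *)
  rewrite mulrnAr; have [ni|ni] := ltnP n i.+1; first by rewrite bin_small.
  by rewrite mulrCA -exprS -subSn.
by rewrite mulrnAr mulrA -exprS.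
Qed.

Lemma binomial_prob_lt (R : realType) n k (p : R) : 0 <= p <= 1 ->
  binomial_prob n p [set j | (j < k)%N] = (binom_lt n k p)%:E.
Proof.
move=> p01; rewrite /binomial_prob p01 esum_fset//=; last first.
  by move=> i _; rewrite lee_fin binomial_pmf_ge0.
by rewrite -fsbig_ord /= sumEFin binom_ltE.
Qed.

(** The bound on [(1 - delta) ^+ n] says that having no success has probability below [gamma], so
    the quantile is positive; its predecessor is then a candidate that fails by minimality. *)
Lemma binom_lt_quantile (R : realType) (gamma : R) n (delta : R) :
  0 <= delta <= 1 -> (1 - delta) ^+ n < gamma <= 1 ->
  (0 < binom_quantile gamma n delta)%N /\
  binom_lt n (binom_quantile gamma n delta) delta < gamma.
Proof.
move=> d01 /andP[gn g1]; rewrite /binom_quantile; case: arg_minnP => /=.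
  rewrite (_ : [set k | (k <= n)%N] = [set k | (k < n.+1)%N])//.
  rewrite binomial_prob_lt// binom_ltE lee_fin (le_trans g1)// /binomial_pmf.
  under eq_bigr do rewrite mulrC.
  by rewrite -exprDn subrK expr1n.
move=> t; rewrite (_ : [set k | (k <= t)%N] = [set k | (k < t.+1)%N])//.
rewrite binomial_prob_lt// lee_fin => gt tmin.
have t0 : (0 < t)%N.
  rewrite lt0n; apply/negP => /eqP t0; move: gt; rewrite t0 binom_ltE big_ord1.
  by rewrite /binomial_pmf bin0 expr0 mul1r subn0 mulr1n leNgt gn.
split => //; rewrite ltNge; apply/negP => gt'.
have tn : (t.-1 < n.+1)%N by rewrite (leq_ltn_trans (leq_pred _)).
have := tmin (Ordinal tn); rewrite (_ : [set k | _] = [set k | (k < t)%N]).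
  rewrite binomial_prob_lt// lee_fin => /(_ gt') /=.
  by case: (nat_of_ord t) t0 => //= s _; rewrite ltnn.
by apply/seteqP; split => k /=; case: (nat_of_ord t) t0.
Qed.

(** * Number of samples falling in a set *)

Lemma measurable_count d (T : measurableType d) n (A : set T) :
  measurable A ->
  measurable_fun [set: n.-tuple T] (fun v : n.-tuple T => count (mem A) v).
Proof.
move=> mA.
(* Counting along [enum 'I_n] permits induction on the index list while the tuple length stays
   fixed. *)
rewrite (_ : (fun v => _) =
    (fun v : n.-tuple T => count (mem A) (map (tnth v) (enum 'I_n))));
  last first.
  by apply/funext => v; rewrite map_tnth_enum.
elim: (enum 'I_n) => [|i s IHs] //=.
apply: measurable_fun_addn => //.
apply: (@measurableT_comp _ _ _ _ _ _ nat_of_bool) => //.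
apply: (measurable_fun_bool true).
rewrite setTI (_ : _ @^-1` _ = (@tnth n T)^~ i @^-1` A); last first.
  by apply/seteqP; split => v /=; [exact: set_mem|exact: mem_set].
by rewrite -[X in measurable X]setTI; exact: measurable_tnth.
Qed.

Lemma measurable_count_lt d (T : measurableType d) n k (A : set T) :
  measurable A ->
  measurable [set v : n.-tuple T | (count (mem A) v < k)%N].
Proof.
move=> mA; rewrite -[X in measurable X]setTI.
exact: (measurable_count mA measurableT (Y := [set j | (j < k)%N])).
Qed.

Lemma product_law_count d (T : measurableType d) (R : realType)
    (P : probability T R) n k (A : set T) (p : R) :
  measurable A -> P A = p%:E ->
  product_law P n [set v : n.-tuple T | (count (mem A) v < k)%N] =
  (binom_lt n k p)%:E.
Proof.
move=> mA PA; elim: n k => [|n IHn] [|k].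
- by rewrite (_ : [set _ | _] = set0) ?measure0//; apply/seteqP; split.
- rewrite (_ : [set _ | _] = setT) ?probability_setT//.
  by apply/seteqP; split => // v _; rewrite tuple0.
- by rewrite (_ : [set _ | _] = set0) ?measure0//; apply/seteqP; split.
rewrite /= /distribution /pushforward /=.
(* If the first draw hits [A], fewer than [k] of the others may; if not, fewer than [k.+1]. *)
have -> : cons_pair (n:=n) @^-1`
    [set v : n.+1.-tuple T | (count (mem A) v < k.+1)%N] =
    (A `*` [set v : n.-tuple T | (count (mem A) v < k)%N]) `|`
    (~` A `*` [set v : n.-tuple T | (count (mem A) v < k.+1)%N]).
  apply/seteqP; split => [[x v] /=|[x v] /= []].
    case: (pselect (A x)) => Ax; first by rewrite mem_set//; left.
    by rewrite memNset//; right.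
  - by move=> [Ax]; rewrite mem_set.
  - by move=> [Ax]; rewrite memNset.
have mC j : measurable [set v : n.-tuple T | (count (mem A) v < j)%N].
  exact: measurable_count_lt.
have mAC := measurableC mA.
rewrite measureU; [|exact: measurableX|exact: measurableX|]; last first.
  by apply/seteqP; split => // -[x v] /= [[? _] [? _]].
rewrite [X in X + _ = _]product_measure1E// [X in _ + X = _]product_measure1E//.
have -> : (P A * product_law P n [set v | (count (mem A) v < k)%N] =
    p%:E * (binom_lt n k p)%:E)%E.
  by rewrite IHn PA.
have -> // : (P (~` A) *
    product_law P n [set v | (count (mem A) v < k.+1)%N] =
    (1 - p)%:E * (binom_lt n k.+1 p)%:E)%E.
by rewrite IHn probability_setC// PA.
Qed.

(** * Order statistics and quantiles *)

(** In the sorted list, all entries from position [k.-1] on exceed [z], so only the first [k.-1] can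
    be at most [z]. If [k] exceeds [n], that tail is empty. *)
Lemma count_order_stat (R : realType) n (Z : 'I_n -> R) (k : nat) (z : R) :
  (0 < k)%N -> z < order_stat Z k ->
  (count (fun y => (y <= z)%R) (codom Z) < k)%N.
Proof.
move=> k0; rewrite /order_stat => zk.
have -> : count (fun y => y <= z) (codom Z) =
    count (fun y => y <= z) (sort <=%R (codom Z)).
  by apply/esym/seq.permP; rewrite perm_sort.
set s := sort _ _ in zk *.
have ss : sorted <=%R s by exact: sort_le_sorted.
rewrite -(cat_take_drop k.-1 s) count_cat [X in (_ + X)%N](_ : _ = 0%N).
  rewrite addn0 (leq_ltn_trans (count_size _ _))//.
  by rewrite -[ltnRHS](prednK k0) ltnS size_take_min geq_minl.
apply/eqP; rewrite -leqn0 leqNgt -has_count; apply/negP => /hasP[y].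
move=> /(nthP 0)[i]; rewrite size_drop ltn_subRL => isz; rewrite nth_drop => <-.
rewrite leNgt (lt_le_trans zk)//.
apply: (sorted_leq_nth le_trans le_refl) => //; rewrite ?inE ?leq_addr//.
by rewrite (leq_ltn_trans _ isz)// leq_addr.
Qed.

(** Take [z = inf S], where [S] is the set on which the cdf reaches [delta]. Right continuity gives
    the first bound. For the second, if [y <= z] then [X < y] is the increasing union of events
    [X <= y - 1/(n+1)], each of probability below [delta]. *)
Lemma exists_quantile d (T : measurableType d) (R : realType)
    (P : probability T R) (X : {RV P >-> R}) (delta : R) : 0 < delta < 1 ->
  exists2 z, (delta%:E <= P [set x | (X x <= z)%R])%E &
    forall y, (delta%:E < P [set x | (X x < y)%R])%E -> z < y.
Proof.
move=> /andP[d0 d1].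
have cdfE r : cdf X r = P [set x | X x <= r].
  by rewrite /cdf /distribution /pushforward; congr (P _).
pose S := [set y | (delta%:E <= cdf X y)%E].
(* The limit 0 of the cdf at minus infinity bounds [S] below; the limit 1 at plus infinity will make
   it nonempty. *)
have [r0 r0S] : exists r0, (cdf X r0 < delta%:E)%E.
  apply: contrapT => /forallNP S_all.
  have : (delta%:E <= 0)%E.
    apply: (cvge_to_ge (cvg_cdfNy0 X)); apply: nearW => r.
    by rewrite leNgt; exact/negP/S_all.
  by rewrite lee_fin leNgt d0.
have Slb : lbound S r0.
  move=> y Sy; rewrite leNgt; apply/negP => /ltW /(cdf_nondecreasing X) yr0.
  by have := le_lt_trans (le_trans Sy yr0) r0S; rewrite ltxx.
have S0 : S !=set0.
  apply: contrapT => /forallNP S_none.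
  have : (1 <= delta%:E)%E.
    apply: (cvge_to_le (cvg_cdfy1 X)); apply: nearW => r.
    by rewrite leNgt; apply/negP => /ltW; exact: S_none.
  by rewrite lee_fin leNgt d1.
exists (inf S).
  rewrite -cdfE; apply: (cvge_to_ge (@cdf_right_continuous _ _ _ _ X (inf S))).
  near=> r.
  have [s Ss sr] : exists2 s, S s & s < r.
    by apply/inf_lt => //; split => //; exists r0.
  by rewrite (le_trans Ss)// cdf_nondecreasing// ltW.
move=> y; apply: contraPP => /negP; rewrite -leNgt => yS.
apply/negP; rewrite -leNgt.
have -> : [set x | X x < y] = \bigcup_n [set x | X x <= y - n.+1%:R^-1].
  apply/seteqP; split => [x /= xy|x [n _] /= xn]; last first.
    by rewrite (le_lt_trans xn)// ltrBlDr ltrDl.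
  have e0 : 0 < y - X x by rewrite subr_gt0.
  have [n _ /(_ n (leqnn n)) /= nP] := near_infty_natSinv_lt (PosNum e0).
  by exists n => //=; rewrite lerBrDr -lerBrDl ltW.
have mle r : measurable [set x | X x <= r].
  rewrite (_ : [set _ | _] = X @^-1` `]-oo, r]) //.
  by rewrite -[Y in measurable Y]setTI; exact: measurable_funP.
set F := fun n => [set x | X x <= y - n.+1%:R^-1].
have ndF : nondecreasing_seq F.
  move=> m n mn; apply/subsetPset => x /= /le_trans; apply.
  by rewrite lerB// lef_pV2 ?posrE// ler_nat.
have := nondecreasing_cvg_mu (mu := P) (fun n => mle _)
  (bigcup_measurable (fun n _ => mle _)) ndF.
move=> /cvge_to_le; apply; apply: nearW => n /=.
rewrite -cdfE leNgt; apply/negP => /ltW nS.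
have : inf S <= y - n.+1%:R^-1 by apply: ge_inf => //; exists r0.
by rewrite leNgt (lt_le_trans _ yS)// ltrBlDr ltrDl.
Unshelve. all: by end_near. Qed.

(** * Full measure of the support *)

(** The filter [F] generated by boxes converges to [v] in each coordinate, hence in the product
    topology, so each neighbourhood of [v] contains a box. *)
Lemma nbhs_tupleP (T : ptopologicalType) n (v : n.-tuple T)
    (W : set (n.-tuple T)) :
  nbhs v W -> exists2 B : 'I_n -> set T, (forall i, nbhs (tnth v i) (B i)) &
    [set w | forall i, B i (tnth w i)] `<=` W.
Proof.
rewrite nbhsE => -[_ [[A oA <-] Av]] AW.
pose F := filter_from [set B : 'I_n -> set T | forall i, nbhs (tnth v i) (B i)]
  (fun B => [set w : {ptws 'I_n -> T} | forall i, B i (w i)]).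
have FF : Filter F.
  apply: filter_from_filter; first by exists (fun=> setT) => i; exact: filterT.
  move=> B C Bv Cv; exists (fun i => B i `&` C i) => [i|w BC].
    exact: filterI.
  by split => i; have [] := BC i.
have : F --> ((fun i => tnth v i) : {ptws 'I_n -> T}).
  apply/cvg_sup => i U /= [_ [[C oC <-] /= Cv CU]].
  (* A box that constrains coordinate [i] alone. *)
  exists (fun j => if j == i then C else setT) => [j /=|w /(_ i)].
    case: eqP => [->|_]; last exact: filterT.
    exact: open_nbhs_nbhs.
  by rewrite eqxx => /CU.
move=> /(_ A) [|B Bv BA]; first exact: open_nbhs_nbhs.
by exists B => // w Bw; apply: AW; exact: BA.
Qed.

(** A countable base of [R^k]: rational centres and radii [1/(m+1)], with an index type that
    [pickle] can encode. *)
Definition rat_ball (R : realType) k (c : 'cV[rat]_k * nat) : set 'cV[R]_k :=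
  ball (map_mx ratr c.1 : 'cV[R]_k) c.2.+1%:R^-1.

Lemma rat_ball_nbhs (R : realType) k (x : 'cV[R]_k) (B : set 'cV[R]_k) :
  nbhs x B -> exists2 c, rat_ball c x & rat_ball c `<=` B.
Proof.
move=> /nbhs_ballP[e /= e0 eB].
have e20 : 0 < e / 2 by rewrite divr_gt0.
have [m _ /(_ m (leqnn m)) /= mP] := near_infty_natSinv_lt (PosNum e20).
(* A rational centre within [1/(m+1) < e/2] of [x]: by the triangle inequality its ball stays within
   distance [e] of [x]. *)
have /choice[a aP] : forall i : 'I_k, exists a : rat,
    x i 0 < (ratr a : R) < x i 0 + m.+1%:R^-1.
  move=> i; have /rat_in_itvoo[a] : x i 0 < x i 0 + m.+1%:R^-1 by rewrite ltrDl.
  by rewrite inE /= => aP; exists a.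
have cx : rat_ball (\col_i a i, m) x.
  split => [|i j]; first by rewrite /= invr_gt0.
  rewrite /ball /= !mxE [j]ord1; have /andP[? ?] := aP i.
  by rewrite ger0_norm ?subr_ge0 1?ltW// ltrBlDl.
exists (\col_i a i, m) => // y cy; apply: eB.
have := ball_triangle (ball_sym cx) cy; apply: le_ball => /=.
by rewrite [leRHS]splitr lerD// ltW.
Qed.

Lemma open_measurable_mx (R : realType) m n (A : set 'M[R]_(m, n)) :
  open A -> measurable A.
Proof. by move=> oA; exact: sub_sigma_algebra. Qed.

Lemma continuous_measurable_mx (R : realType) m n (f : 'M[R]_(m, n) -> R) :
  continuous f -> measurable_fun setT f.
Proof.
move=> /continuousP cf; apply: (measurability _ (RGenOpens.measurableE R)).
move=> _ [_ [a [b ->] <-]]; rewrite setTI; apply: open_measurable_mx.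
exact/cf/interval_open.
Qed.

(** A point off the support has a box neighbourhood that misses some set of probability one and is
    therefore contained in a null set. Shrinking its sides to rational balls leaves only countably
    many null boxes to cover. *)
Lemma prob_support_full (R : realType) k n
    (Q : probability (n.-tuple 'cV[R]_k) R) :
  Q.-negligible (~` prob_support Q).
Proof.
pose box (b : {ffun 'I_n -> 'cV[rat]_k * nat}) : set (n.-tuple 'cV[R]_k) :=
  [set v | forall i, rat_ball (b i) (tnth v i)].
have mbox b : measurable (box b).
  rewrite (_ : box b =
      \bigcap_(i in [set: 'I_n]) ((@tnth n _)^~ i @^-1` rat_ball (b i))).
    apply: fin_bigcap_measurable => // i _.
    rewrite -[X in measurable X]setTI; apply: measurable_tnth => //.
    by apply: open_measurable_mx; rewrite /rat_ball; exact: ball_open.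
  by apply/seteqP; split => v bv i => [_|]; exact: bv.
(* Integers coding no box, and boxes of positive mass, yield the empty set, so every [F j] is
   null. *)
pose F j := if unpickle j is Some b then
  if Q (box b) == 0%E then box b else set0 else set0.
have F0 j : Q.-negligible (F j).
  rewrite /F; case: unpickle => [b|]; last exact: negligible_set0.
  case: ifPn => [/eqP Qb|_]; last exact: negligible_set0.
  exact/negligibleP.
apply: negligibleS (negligible_bigcup F0) => v.
move=> /existsNP[A /not_implyP[[mA QA]]].
move=> /existsNP[W /not_implyP[/nbhs_tupleP[B vB BW] AW0]].
have /choice[b bP] : forall i, exists c,
    rat_ball c (tnth v i) /\ rat_ball c `<=` B i.
  by move=> i; have [c ? ?] := rat_ball_nbhs (vB i); exists c.
exists (pickle (finfun b)) => //; rewrite /F pickleK ifT.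
  by move=> i; rewrite ffunE; have [] := bP i.
have Qc : Q (~` A) = 0%E by rewrite probability_setC// QA subee.
apply/eqP; apply: subset_measure0 Qc => //; first exact: measurableC.
move=> w bw Aw; apply: AW0; exists w; split => //; apply: BW => i.
by have [_] := bP i; apply; have := bw i; rewrite ffunE.
Qed.

(** * Superlevel sets of the min-max function *)

Lemma fmin_ge (R : realType) p (F : 'I_p.+1 -> R) (z : R) :
  (z <= fmin F) <-> (forall i, z <= F i).
Proof.
split => [/bigmin_geP[_ zF] i|zF]; first exact: zF.
by apply/bigmin_geP; split => [|i _]; exact: zF.
Qed.

Lemma fmax_ge (R : realType) p (F : 'I_p.+1 -> R) (z : R) :
  (z <= fmax F) <-> (exists i, z <= F i).
Proof.
split => [/bigmax_geP[zF|[i _ zF]]|[i zF]].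
- by exists ord0.
- by exists i.
- by apply/bigmax_geP; right; exists i.
Qed.

(** Serves twice: it makes the safety event a finite intersection of finite unions of affine
    conditions, hence measurable, and it reduces safety to one good [j] for each [i]. *)
Lemma hfun_ge (R : realType) (n p : nat) (q : 'I_p.+1 -> nat)
    (c : forall i, 'I_(q i).+1 -> 'cV[R]_n) (b : forall i, 'I_(q i).+1 -> R)
    (x : 'cV[R]_n) (z : R) :
  (z <= hfun c b x) <-> (forall i, exists j, z <= dot (c i j) x - b i j).
Proof.
rewrite /hfun fmin_ge; split => zx i; first exact/fmax_ge.
by apply/fmax_ge; exact: zx.
Qed.

Lemma dotD (R : realType) n (c x y : 'cV[R]_n) :
  dot c (x + y) = dot c x + dot c y.
Proof. by rewrite /dot mulmxDr mxE. Qed.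

Lemma measurable_dot (R : realType) n (c : 'cV[R]_n) :
  measurable_fun setT (dot c).
Proof.
rewrite (_ : dot c = fun y => \sum_i c i 0 * y i 0); last first.
  by apply/funext => y; rewrite /dot mxE; apply: eq_bigr => i _; rewrite mxE.
apply: measurable_sum => i; apply: measurable_funM => //.
by apply: continuous_measurable_mx; exact: coord_continuous.
Qed.

(** * Coverage by one order statistic *)

(** The exceptional set [C] is a count event, so its measurability does not rest on that of the
    probability bounded in the conclusion. *)
Lemma order_stat_coverage d (T : measurableType d) (R : realType)
    (P : probability T R) (X : T -> R) n (gamma delta : R) :
  measurable_fun setT X -> 0 < delta < 1 -> (1 - delta) ^+ n < gamma <= 1 ->
  exists C : set (n.-tuple T),
    [/\ measurable C, (product_law P n C <= gamma%:E)%E &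
    forall v, ~ C v ->
      (P [set x | (X x < order_stat (fun t => X (tnth v t))
                              (binom_quantile gamma n delta))%R]
        <= delta%:E)%E].
Proof.
move=> mX d01 gn.
have mA z : measurable [set x | X x <= z].
  rewrite (_ : [set _ | _] = X @^-1` `]-oo, z]) //.
  by rewrite -[Y in measurable Y]setTI; exact: mX.
pose X' : {RV P >-> R} := mfun_Sub (mem_set mX).
have [z Pz zP] := exists_quantile X' d01.
move: d01 => /andP[d0 d1].
have d01 : 0 <= delta <= 1 by rewrite !ltW.
have [t0 tgamma] := binom_lt_quantile d01 gn.
set t := binom_quantile _ _ _ in t0 tgamma *.
exists [set v | (count (mem [set x | (X x <= z)%R]) v < t)%N]; split.
- exact: measurable_count_lt.
- have PE : P [set x | X x <= z] = (fine (P [set x | X x <= z]))%:E.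
    by rewrite fineK// fin_num_measure.
  rewrite (product_law_count _ _ (mA z) PE) lee_fin (le_trans _ (ltW tgamma))//.
  (* Atoms may push [P(X <= z)] above [delta]; monotonicity in the success probability leads back to
     [delta]. *)
  apply: binom_lt_antimono; first exact: ltW.
    by rewrite -lee_fin -PE.
  by rewrite -lee_fin -PE probability_le1.
- move=> v Cv; rewrite leNgt; apply/negP => /zP /(count_order_stat t0).
  apply: contra_not Cv => /=.
  rewrite /= codomE -(map_tnth_enum v) !count_map.
  move=> Ct; apply: leq_ltn_trans Ct; apply: sub_count => i /=.
  by move=> /set_mem.
Qed.

(** * Sample size condition and union bound *)

(** Since [ln x < 0], clearing the denominator reverses the inequality. This turns the bound on [D]
    into the hypothesis of [binom_lt_quantile]. *)
Lemma expr_lt_of_ln (R : realType) (x y : R) n : 0 < x < 1 -> 0 < y ->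
  ln y / ln x < n%:R -> x ^+ n < y.
Proof.
move=> /andP[x0 x1] y0; rewrite ltr_ndivrMr; last by rewrite ln_lt0// x0.
by rewrite mulr_natl -lnXn// ltr_ln// posrE exprn_gt0.
Qed.

(** Applied once to the data, with [N] the complement of the support, and once to the fresh sample,
    with [N] empty. A measurable null set [M] stands in for [N]. *)
Lemma probability_ge_compl_bigcup d (T : measurableType d) (R : realType)
    (Q : probability T R) (I : finType) (C : I -> set T) (N B : set T) (e : R) :
  (forall i, measurable (C i)) -> Q.-negligible N -> measurable B ->
  (\sum_i Q (C i) <= e%:E)%E ->
  (forall v, ~ N v -> (forall i, ~ C i v) -> B v) ->
  ((1 - e)%:E <= Q B)%E.
Proof.
move=> mC [M [mM M0 NM]] mB Ce CB.
rewrite -[B]setCK probability_setC; last exact: measurableC.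
have QB : (Q (~` B) <= e%:E)%E.
  have QU : (Q (\bigcup_(i in [set` enum I]) C i) <= e%:E)%E.
    apply: le_trans Ce; rewrite -big_enum fsbig_seq ?enum_uniq//.
    by apply: content_sub_fsum => //; exact: fin_bigcup_measurable.
  have mU : measurable (\bigcup_(i in [set` enum I]) C i).
    exact: fin_bigcup_measurable.
  have QMU : (Q (M `|` \bigcup_(i in [set` enum I]) C i) <=
      Q M + Q (\bigcup_(i in [set` enum I]) C i))%E by exact: measureU2.
  rewrite M0 add0e in QMU; apply: le_trans (le_trans QMU QU).
  apply: le_measure; rewrite ?inE; [exact: measurableC|exact: measurableU|].
  move=> v Bv; apply: contrapT => /not_orP[Mv Cv]; apply/Bv/CB => [/NM//|i Ci].
  by apply: Cv; exists i => //=; rewrite mem_enum.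
by rewrite EFinB leeB.
Qed.

(** * From coverage to the barrier property *)

Theorem lemma4 (R : realType) (n m nxi : nat)
    (U : set 'cV[R]_m) (U_neq0 : U !=set0) (U_closed : closed U)
    (U_convex : convex_set (U : set (convex_lmodType 'cV[R]_m)))
    (f : 'cV[R]_n -> 'cV[R]_m -> 'cV[R]_n)
    (f_meas : measurable_fun (setT `*` U) (fun xu : 'cV[R]_n * 'cV[R]_m => f xu.1 xu.2))
    (g : 'cV[R]_n -> 'cV[R]_nxi -> 'cV[R]_n)
    (g_meas : measurable_fun setT (fun xxi : 'cV[R]_n * 'cV[R]_nxi => g xxi.1 xxi.2))
    (P : probability 'cV[R]_nxi R)
    (alpha : R) (alpha01 : 0 <= alpha <= 1)
    (p : nat) (q : 'I_p.+1 -> nat)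
    (c : forall i, 'I_(q i).+1 -> 'cV[R]_n) (b : forall i, 'I_(q i).+1 -> R)
    (gamma delta : R) (gamma01 : 0 < gamma < 1) (delta01 : 0 < delta < 1)
    (delta_ : 'I_p.+1 -> R) (delta_E : forall i, delta_ i = delta / p.+1%:R)
    (ntot : nat) (ntotE : ntot = (\sum_(i < p.+1) (q i).+1)%N)
    (D : nat)
    (D_gt : fmax (fun i => ln (gamma / ntot%:R) / ln (1 - delta_ i)) < D%:R)
    (tau : 'I_p.+1 -> nat)
    (tauE : forall i, tau i = binom_quantile (gamma / ntot%:R) D (delta_ i))
    (kappa : D.-tuple 'cV[R]_nxi -> 'cV[R]_n -> 'cV[R]_m)
    (kappa_U : forall data x, U (kappa data x))
    (kappa_meas_state : forall data, measurable_fun setT (kappa data))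
    (kappa_meas_data : forall x, measurable_fun setT (kappa^~ x)) :
  (forall data x, prob_support (product_law P D) data -> safe_set (hfun c b) x ->
    exists j : forall i : 'I_p.+1, 'I_(q i).+1,
    forall i : 'I_p.+1,
      dot (c i (j i)) (f x (kappa data x))
        - (b i (j i) + alpha * hfun c b x)
      >= - order_stat (fun t => dot (c i (j i)) (g x (tnth data t))) (tau i)) ->
  is_PCBF (fun x u xi => f x u + g x xi) U P D alpha (hfun c b) delta gamma.
Proof.
move=> kappaP x xS; exists (kappa^~ x); split => //.
set z := alpha * hfun c b x.
have mX i j : measurable_fun setT (fun xi => dot (c i j) (g x xi)).
  apply: (measurableT_comp (measurable_dot _)).
  exact: (measurableT_comp g_meas (pair1_measurable x)).
have mfx : measurable_fun setT (fun data => f x (kappa data x)).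
  (* [f_meas] concerns inputs in [U], which is Borel because it is closed and contains all values of
     [kappa]. *)
  apply: (measurable_comp _ _ f_meas (g := fun data => (x, kappa data x))).
  - by apply: measurableX => //; rewrite -[U]setCK; apply: measurableC;
      apply: open_measurable_mx; exact: closed_openC.
  - by move=> _ [data _ <-]; split => //=; exact: kappa_U.
  - exact: (measurableT_comp (pair1_measurable x) (kappa_meas_data x)).
pose W := [set w : D.-tuple 'cV[R]_nxi * 'cV[R]_nxi |
  z <= hfun c b (f x (kappa w.1 x) + g x w.2)].
have mW : measurable W.
  rewrite (_ : W =
      \bigcap_(i in [set: 'I_p.+1]) \bigcup_(j in [set: 'I_(q i).+1])
      [set w | z <= dot (c i j) (f x (kappa w.1 x))
                    + dot (c i j) (g x w.2) - b i j]).
    apply: fin_bigcap_measurable => // i _.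
    apply: fin_bigcup_measurable => // j _.
    rewrite -[X in measurable X]setTI; apply: measurable_fun_le => //.
    apply: measurable_funB => //; apply: measurable_funD.
      apply: (measurableT_comp (measurable_dot _)).
      exact: (measurableT_comp mfx).
    exact: (measurableT_comp (mX i j)).
  apply/seteqP; split => w.
    by move=> /hfun_ge zw i _; have [j] := zw i; rewrite dotD; exists j.
  move=> zw; apply/hfun_ge => i; have [j _] := zw i I.
  by exists j; rewrite dotD.
have WE v : xsection W v = [set xi | z <= hfun c b (f x (kappa v x) + g x xi)].
  by apply/seteqP; split => xi; rewrite /xsection /= in_setE.
(* The inner probability is that of a section of [W], so it depends measurably on the data. *)
have mB : measurable [set data | (1 - delta)%:E <=
    P [set xi | (z <= hfun c b (f x (kappa data x) + g x xi))%R]]%E.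
  rewrite -[X in measurable X]setTI.
  under eq_set do rewrite -WE.
  exact: (emeasurable_fun_c_infty measurableT (measurable_fun_xsection P mW)).
have ntot0 : 0 < ntot%:R :> R.
  by rewrite ltr0n ntotE big_ord_recl.
have gammaE : gamma / ntot%:R <= 1.
  rewrite ler_pdivrMr// mul1r (le_trans (ltW (andP gamma01).2))// ler1n.
  by rewrite -(ltr0n R).
have deltaE i : 0 < delta_ i < 1.
  have /andP[d0 d1] := delta01.
  rewrite delta_E divr_gt0//= ltr_pdivrMr// mul1r (lt_le_trans d1)//.
  by rewrite ler1n.
pose Z (s : {i : 'I_p.+1 & 'I_(q i).+1}) xi :=
  dot (c (tag s) (tagged s)) (g x xi).
(* The indices [j_i] may depend on the data, so an exceptional event is set aside for every pair
   [(i, j)]. *)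
have /choice[C CP] : forall s, exists C : set (D.-tuple 'cV[R]_nxi),
    [/\ measurable C, (product_law P D C <= (gamma / ntot%:R)%:E)%E &
    forall v, ~ C v ->
      (P [set xi | (Z s xi <
          order_stat (fun t => Z s (tnth v t)) (tau (tag s)))%R]
        <= (delta_ (tag s))%:E)%E].
  move=> s; rewrite tauE; apply: order_stat_coverage => //; first exact: mX.
  rewrite gammaE andbT expr_lt_of_ln ?divr_gt0//.
  - have /andP[? ?] := deltaE (tag s).
    by apply/andP; split; lra.
  - by case/andP: gamma01.
  - apply: le_lt_trans D_gt.
    exact: (le_bigmax _ (fun i => ln (gamma / ntot%:R) / ln (1 - delta_ i))).
apply: (probability_ge_compl_bigcup (C := C) _ (prob_support_full _) mB).
- by move=> s; have [] := CP s.
- apply: (@le_trans _ _ (\sum_(s : {i : 'I_p.+1 & 'I_(q i).+1})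
    (gamma / ntot%:R)%:E)%E).
    by apply: lee_sum => s _; have [] := CP s.
  (* There are [ntot] pairs, each costing [gamma / ntot]. *)
  rewrite sumEFin sumr_const tagnat.card -ntotE.
  by rewrite -[_ / _ *+ _]mulr_natr divfK// gt_eqF.
move=> v /contrapT vsupp Cv /=.
have [j jP] := kappaP v x vsupp xS.
pose Zj i := Z (Tagged (fun i => 'I_(q i).+1) (j i)).
(* With the data fixed, so are the [j i]; only [p.+1] events remain, each costing [delta / p.+1]. *)
apply: (probability_ge_compl_bigcup (N := set0) (C := fun i =>
  [set xi | Zj i xi < order_stat (fun t => Zj i (tnth v t)) (tau i)])).
- move=> i; set r := order_stat _ _.
  rewrite (_ : [set _ | _] = Zj i @^-1` `]-oo, r[)//.
  by rewrite -[X in measurable X]setTI; exact: mX.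
- exact: negligible_set0.
- by rewrite -WE; exact: measurable_xsection.
- apply: (@le_trans _ _ (\sum_i (delta_ i)%:E)%E).
    apply: lee_sum => i _.
    have [_ _] := CP (Tagged (fun i => 'I_(q i).+1) (j i)).
    by apply; exact: Cv.
  rewrite sumEFin lee_fin; under eq_bigr do rewrite delta_E.
  by rewrite sumr_const card_ord -[_ / _ *+ _]mulr_natr divfK.
move=> xi _ Cxi; apply/hfun_ge => i; exists (j i); rewrite dotD.
(* The fresh score is at least the order statistic, whose negative bounds the controlled part from
   below; the two cancel. *)
have := jP i; have /negP := Cxi i; rewrite -leNgt /Zj /Z /z /=; lra.
Qed.
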